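(* Let $G$ be a connected non-bipartite graph, let $k$ be a positive integer, and let $f$ be an integer additive set-indexer of $G$. Then $f$ is a strongly $k$-uniform integer additive set-indexer if and only if $k$ is a perfect square and $f$ is a $(k,l)$-completely uniform integer additive set-indexer with $l=\sqrt{k}$.
   Context: All graphs are simple, finite and have no isolated vertices. Set-labels are non-empty finite subsets of the non-negative integers $\mathbb{N}_0$. For sets $A,B$, $A+B=\{a+b: a\in A, b\in B\}$. An integer additive set-indexer (IASI) of $G$ is an injective $f:V(G)\to 2^{\mathbb{N}_0}$ such that $f^+:E(G)\to 2^{\mathbb{N}_0}$, $f^+(uv)=f(u)+f(v)$, is injective. An IASI is $k$-uniform if $|f^+(e)|=k$ for all edges $e$. It is strong if $|f^+(uv)|=|f(u)|\,|f(v)|$ for every edge $uv$, and strongly $k$-uniform if it is strong and $k$-uniform. An IASI $f$ is $(k,l)$-completely uniform if it is $k$-uniform and $|f(v)|=l$ for every vertex $v$. *)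

(* Defs.v *)
From mathcomp Require Export all_boot finmap.

Set Implicit Arguments.
Unset Strict Implicit.
Unset Printing Implicit Defensive.

Record sgraph := SGraph {
  vertex :> finType;
  adj : rel vertex;
  adj_sym : symmetric adj;
  adj_irr : irreflexive adj
}.

Definition no_isolated_vertex (G : sgraph) : Prop :=
  forall u : G, exists v : G, adj u v.

Definition connected_graph (G : sgraph) : Prop :=
  0 < #|G| /\ forall u v : G, connect (@adj G) u v.

Definition bipartite (G : sgraph) : Prop :=
  exists A B : {set G},
    [/\ A :|: B = [set: G], [disjoint A & B]
      & forall u v : G, adj u v ->
          (u \in A) && (v \in B) || (u \in B) && (v \in A)].

Definition sumset (A B : {fset nat}) : {fset nat} :=
  [fset (a + b)%N | a in A, b in B]%fset.

(* The edge uv is the unordered pair {u, v}, so injectivity of f^+ on E(G)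
   is stated as equality of two-element sets of vertices. *)
Definition iasi (G : sgraph) (f : G -> {fset nat}) : Prop :=
  [/\ forall v : G, f v != fset0,
      injective f
    & forall u v x y : G, adj u v -> adj x y ->
        sumset (f u) (f v) = sumset (f x) (f y) ->
        [set u; v] = [set x; y]].

Definition uniform_iasi (G : sgraph) (k : nat) (f : G -> {fset nat}) : Prop :=
  iasi f /\ forall u v : G, adj u v -> #|` sumset (f u) (f v)| = k.

Definition strong_iasi (G : sgraph) (f : G -> {fset nat}) : Prop :=
  iasi f /\
  forall u v : G, adj u v -> #|` sumset (f u) (f v)| = #|` f u| * #|` f v|.

Definition strongly_uniform_iasi (G : sgraph) (k : nat)
    (f : G -> {fset nat}) : Prop :=
  strong_iasi f /\ uniform_iasi k f.

Definition completely_uniform_iasi (G : sgraph) (k l : nat)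
    (f : G -> {fset nat}) : Prop :=
  uniform_iasi k f /\ forall v : G, #|` f v| = l.

(* Main.v *)
(** The sizes [|f v|] multiply to [k] along every edge.  By connectedness they
    all lie in [{a, k / a}], where [a] is the size at a fixed vertex; if
    [a ^ 2 <> k], these two values are exchanged by every edge, and the vertices
    of size [a] form one side of a bipartition. *)

Require Import Defs.
From mathcomp Require Import all_boot finmap.

Lemma connect_forward_closed (T : finType) (e : rel T) (P : pred T) x y :
  (forall u v, e u v -> P u -> P v) -> connect e x y -> P x -> P y.
Proof.
move=> Pe /connectP[p + ->]; elim: p x => //= z p IHp x /andP[exz pz] Px.
exact: IHp pz (Pe _ _ exz Px).
Qed.

Lemma nonbipartite_edge_product (G : sgraph) (k : nat) (g : G -> nat) :
  connected_graph G -> ~ bipartite G -> 0 < k ->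
  (forall u v : G, adj u v -> g u * g v = k) ->
  forall v : G, g v ^ 2 = k.
Proof.
move=> [_ Gconn] Gnbip k_gt0 gk r.
have [//|sq_neq] := eqVneq (g r ^ 2) k; case: Gnbip.
have cancel_g u m n : 0 < g u -> g u * m = k -> g u * n = k -> m = n.
  by move=> gu_gt0 <- /eqP; rewrite eqn_pmul2l // => /eqP.
have g_gt0 u v : adj u v -> (0 < g u) && (0 < g v).
  by move=> uv; rewrite -muln_gt0 (gk _ _ uv).
(* The value [k / g r] is encoded by a product, which avoids division. Crossing an edge turns either
   alternative into the other, the second into the first by cancelling [g u]. *)
have two_values w : (g w == g r) || (g r * g w == k).
  apply: (@connect_forward_closed _ (@adj G)
    (fun w => (g w == g r) || (g r * g w == k)) _ _ _ (Gconn r w)); last first.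
    by rewrite eqxx.
  move=> u v uv /orP[/eqP <-|/eqP rk]; first by rewrite (gk _ _ uv) eqxx orbT.
  have /andP[gu_gt0 _] := g_gt0 _ _ uv; apply/orP; left; apply/eqP.
  by apply: (cancel_g u) => //; [exact: gk | rewrite mulnC].
exists [set w | g w == g r], (~: [set w | g w == g r]); split.
- by rewrite setUCr.
- by rewrite disjoints_subset setCK.
move=> u v uv; rewrite !inE; have guv := gk _ _ uv.
have /andP[gu_gt0 _] := g_gt0 _ _ uv.
(* Two adjacent vertices of value [g r] would give [g r ^ 2 = k]. If [g u] differs from [g r], then
   [g u * g r = k = g u * g v] puts [v] in the first class. *)
have [gu|gu] /= := eqVneq (g u) (g r).
  rewrite orbF; apply: contraNneq sq_neq => gv.
  by rewrite -guv gu gv mulnn.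
have := two_values u; rewrite (negPf gu) /= => /eqP rk.
by apply/eqP; apply: (cancel_g u) => //; rewrite mulnC.
Qed.

Theorem theorem7 (G : sgraph) (k : nat) (f : G -> {fset nat}) :
  no_isolated_vertex G -> connected_graph G -> ~ bipartite G ->
  0 < k -> iasi f ->
  (strongly_uniform_iasi k f <->
   exists l : nat, k = l ^ 2 /\ completely_uniform_iasi k l f).
Proof.
move=> _ Gconn Gnbip k_gt0 fI; split.
  move=> [[_ fstrong] funif].
  have sq (v : G) : #|` f v| ^ 2 = k.
    apply: (@nonbipartite_edge_product G k (fun v => #|` f v|)) => // u w uw.
    by rewrite -fstrong // (proj2 funif).
  (* Connectedness includes non-emptiness, so some vertex [r] can supply [l]; injectivity of
     squaring then makes all label sizes equal. *)
  have [/card_gt0P[r _] _] := Gconn.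
  exists #|` f r|; split; first by rewrite sq.
  by split=> // v; apply/eqP; rewrite -(@eqn_exp2r _ _ 2) // !sq.
move=> [l [kE [funif fl]]]; split=> //; split=> // u v uv.
by rewrite (proj2 funif) // !fl kE mulnn.
Qed.
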